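(* Let $A$ be a set with $|A| = k$ and assume that $n \geq k + 2$. If $f \colon A^n \to B$ is totally symmetric, then $f$ is reconstructible.
   Context: $A$ and $B$ are sets with at least two elements; $k$, $n$ are positive integers. $[n] := \{1,\dots,n\}$, $\binom{[n]}{2}$ denotes the set of all $2$-element subsets of $[n]$, and $\Sigma_n$ is the symmetric group on $[n]$. For $\mathbf{a} \in A^n$ and $\sigma \colon [m] \to [n]$, write $\mathbf{a}\sigma := (a_{\sigma(1)},\dots,a_{\sigma(m)}) \in A^m$. Functions $f, g \colon A^n \to B$ are equivalent, $f \equiv g$, if there is $\sigma \in \Sigma_n$ with $f(\mathbf{a}) = g(\mathbf{a}\sigma)$ for all $\mathbf{a} \in A^n$. For $n \geq 2$, $f \colon A^n \to B$ and $I \in \binom{[n]}{2}$, the identification minor $f_I \colon A^{n-1} \to B$ is given by $f_I(\mathbf{a}) = f(\mathbf{a}\delta_I)$, where $\delta_I \colon [n] \to [n-1]$ is defined by $\delta_I(i) = i$ if $i < \max I$, $\delta_I(i) = \min I$ if $i = \max I$, and $\delta_I(i) = i-1$ if $i > \max I$. The deck of $f$, $\operatorname{deck} f$, is the multiset $\{f_I/{\equiv} : I \in \binom{[n]}{2}\}$ of equivalence classes. A function $g \colon A^n \to B$ is a reconstruction of $f$ if $\operatorname{deck} f = \operatorname{deck} g$. The function $f$ is reconstructible if it is equivalent to all of its reconstructions. $f \colon A^n \to B$ is totally symmetric if $f(\mathbf{a}) = f(\mathbf{a}\sigma)$ for all $\mathbf{a} \in A^n$ and all $\sigma \in \Sigma_n$.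 *)

(* Defs.v *)
From mathcomp Require Import all_boot all_fingroup.
From mathcomp Require Import finmap multiset.
From mathcomp Require Import boolp classical_sets.

Set Implicit Arguments.
Unset Strict Implicit.
Unset Printing Implicit Defensive.

(* A^n is n.-tuple A and [n] is 'I_n, so indices are 0, ..., n - 1. *)

Definition tuple_comp (A : Type) (m n : nat) (a : n.-tuple A)
    (s : 'I_m -> 'I_n) : m.-tuple A :=
  [tuple tnth a (s i) | i < m].

Definition fequiv (A B : Type) (n : nat) (f g : n.-tuple A -> B) : Prop :=
  exists s : 'S_n, forall a : n.-tuple A, f a = g (tuple_comp a s).

Definition fclass (A B : Type) (n : nat) (f : n.-tuple A -> B) :
    set (n.-tuple A -> B) :=
  [set g | fequiv f g]%classic.

Definition pairs (n : nat) := {I : {set 'I_n} | #|I| == 2}.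

Definition maxI (n : nat) (I : pairs n) : nat := \max_(i in val I) i.
(* The default value n is never reached, since the elements of I are < n. *)
Definition minI (n : nat) (I : pairs n) : nat :=
  \big[minn/n]_(i in val I) (i : nat).

(* The three cases are unchanged by the passage to 0-based indices. *)
Definition delta_nat (n : nat) (I : pairs n) (i : nat) : nat :=
  if i < maxI I then i else if i == maxI I then minI I else i.-1.

Lemma minI_le (n : nat) (I : pairs n) (i : 'I_n) : i \in val I -> minI I <= i.
Proof.
move=> Ii; rewrite /minI; have: i \in index_enum 'I_n by rewrite mem_index_enum.
elim: (index_enum _) => [//|j s IHs]; rewrite inE big_cons.
move=> /orP[/eqP <-|/IHs le_i]; first by rewrite Ii geq_minl.
by case: ifP => // _; apply: leq_trans (geq_minr _ _) le_i.
Qed.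

Lemma minI_lt_maxI (n : nat) (I : pairs n) : minI I < maxI I.
Proof.
have /cards2P[i [j [neq_ij Iij]]] := valP I.
have Ii : i \in val I by rewrite Iij !inE eqxx.
have Ij : j \in val I by rewrite Iij !inE eqxx orbT.
have lei (l : 'I_n) : l \in val I -> l <= maxI I.
  by move=> Il; rewrite /maxI; exact: (bigmax_sup l Il).
move: neq_ij; rewrite -val_eqE neq_ltn /= => /orP[lt_ij|lt_ji].
  exact: leq_ltn_trans (minI_le Ii) (leq_trans lt_ij (lei _ Ij)).
exact: leq_ltn_trans (minI_le Ij) (leq_trans lt_ji (lei _ Ii)).
Qed.

Lemma maxI_lt (n : nat) (I : pairs n) : maxI I < n.
Proof.
have n_gt0 : 0 < n.
  by have /cards2P[i _] := valP I; apply: leq_ltn_trans (ltn_ord i).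
have le_max : maxI I <= n.-1.
  by apply/bigmax_leqP => i _; rewrite -ltnS prednK.
by apply: leq_ltn_trans le_max _; rewrite ltn_predL.
Qed.

Lemma delta_subproof (n : nat) (I : pairs n) (i : 'I_n) :
  delta_nat I i < n.-1.
Proof.
have n_gt0 := leq_ltn_trans (leq0n i) (ltn_ord i).
have le_max : maxI I <= n.-1 by rewrite -ltnS prednK ?maxI_lt.
rewrite /delta_nat; case: (ltngtP i (maxI I)) => [lt_i|gt_i|_].
- exact: leq_trans lt_i le_max.
- by rewrite -ltnS !prednK ?(leq_ltn_trans _ gt_i).
- exact: leq_trans (minI_lt_maxI I) le_max.
Qed.

Definition delta (n : nat) (I : pairs n) (i : 'I_n) : 'I_n.-1 :=
  Ordinal (delta_subproof I i).

Definition minor (A B : Type) (n : nat) (f : n.-tuple A -> B) (I : pairs n) :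
    n.-1.-tuple A -> B :=
  fun a => f (tuple_comp a (delta I)).

Definition deck (A B : Type) (n : nat) (f : n.-tuple A -> B) :
    {mset (set (n.-1.-tuple A -> B))}%mset :=
  seq_mset [seq fclass (minor f J) | J <- enum {: pairs n}].

Definition reconstruction (A B : Type) (n : nat) (f g : n.-tuple A -> B) :
    Prop :=
  deck f = deck g.

Definition reconstructible (A B : Type) (n : nat) (f : n.-tuple A -> B) :
    Prop :=
  forall g : n.-tuple A -> B, reconstruction f g -> fequiv f g.

Definition totally_symmetric (A B : Type) (n : nat) (f : n.-tuple A -> B) :
    Prop :=
  forall (a : n.-tuple A) (s : 'S_n), f a = f (tuple_comp a s).

(* Main.v *)
(** Write f(a) = F(multiset of a). All cards of f are equivalent to one function
    with one distinguished argument, so a reconstruction g comes with a map q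
    sending each pair {i, j} of positions to a position such that
    g(a) = F(a - a_i + a_q(i,j)) whenever a_i = a_j. Since n > k, every a has
    such a pair; if q(i,j) is always i or j, then g = f.

    Otherwise consider the exchange P: F(3u + y + R) = F(2u + 2y + R) for all
    u, y, R. Evaluating g in two ways on a tuple with a tripled letter, or with
    two doubled letters, shows that if P fails then q satisfies incidence
    constraints which are contradictory. So P holds, and as n - 1 > k it implies
    F(2x + y + R) = F(x + 2y + R) for all x, y, R, whence again g = f. *)
Require Import Defs.
From mathcomp Require Import all_boot all_fingroup.
From mathcomp Require Import multiset boolp zify.

Set Implicit Arguments.
Unset Strict Implicit.
Unset Printing Implicit Defensive.

(** * Symmetric maps from pairs of positions to positions *)

(** The two conditions are those forced on [q] if the exchange P fails. By [q_opp], [q (q i j) l] is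
    [i] or [j]; up to swapping these, [key] refutes it. *)
Lemma opposite_map_inside (T : eqType) (q : T -> T -> T)
    (qC : forall i j, q i j = q j i)
    (q_triple : forall i j l, i <> j -> i <> l -> j <> l ->
       q i j \notin [:: i; j; l] -> q i l \notin [:: i; j; l])
    (q_opp : forall i j l, uniq [:: i; j; q i j; l] ->
       q (q i j) l \in [:: i; j]) :
  forall i j l, uniq [:: i; j; q i j; l] -> False.
Proof.
have tri i j l : i <> j -> i <> l -> j <> l ->
    q i j <> i -> q i j <> j -> q i j <> l ->
    [/\ q i l <> i, q i l <> j & q i l <> l].
  move=> ij il jl qi qj ql; have := @q_triple i j l ij il jl.
  rewrite !inE !negb_or; case/(_ _)/and3P; last by split; apply/eqP.
  by apply/and3P; split; apply/eqP.
have opp i j k l : q i j = k -> i <> j -> i <> k -> i <> l -> j <> k ->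
    j <> l -> k <> l -> q k l = i \/ q k l = j.
  move=> <- ij ik il jk jl kl; have := @q_opp i j l.
  rewrite /= !inE !negb_or andbT => /(_ _) H.
  suff /H /orP[/eqP|/eqP] : [&& i != j, i != q i j & i != l]
     && ((j != q i j) && (j != l) && (q i j != l)) by auto.
  by do ![apply/andP; split]; apply/eqP.
have key i j k l : q i j = k -> q k l = i -> i <> j -> i <> k -> i <> l ->
    j <> k -> j <> l -> k <> l -> False.
  move=> qij qkl ij ik il jk jl kl.
  have [m1 m2 m3] : [/\ q j l <> j, q j l <> i & q j l <> l].
    by apply: tri; rewrite 1?qC ?qij; congruence.
  have [_ m4 _] : [/\ q l j <> l, q l j <> k & q l j <> j].
    by apply: tri; rewrite 1?qC ?qkl; congruence.
  (* [m] differs from [i], [j], [k], [l]. Now [opp] and [tri] leave one choice for further values: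
     [q k m = j] and [q i m = l]. *)
  rewrite qC in m4; move mE : (q j l) => m in m1 m2 m3 m4.
  have o1 : q m k = j \/ q m k = l by apply: (opp j l); congruence.
  have o2 : q k m = i \/ q k m = j by apply: (opp i j); congruence.
  have qkm : q k m = j by rewrite (qC m k) in o1; intuition congruence.
  have o3 : q m i = j \/ q m i = l by apply: (opp j l); congruence.
  have [p1 p2 p3] : [/\ q i m <> i, q i m <> j & q i m <> m].
    by apply: tri; congruence.
  have qim : q i m = l by rewrite (qC m i) in o3; intuition congruence.
  have [r1 r2 r3] : [/\ q i l <> i, q i l <> j & q i l <> l].
    by apply: tri; congruence.
  move rE : (q i l) => r in r1 r2 r3.
  (* Both [r = k] and [r = m] contradict [q k m = j]. Otherwise [r] is a sixth position,
     [q k r = i], and [q i m] would be [k] or [r]. *)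
  case: (eqVneq r k) => [rk | /eqP rk].
    have : q k m = i \/ q k m = l by apply: (opp i l); congruence.
    by intuition congruence.
  case: (eqVneq r m) => [rm | /eqP rm].
    have : q m k = i \/ q m k = l by apply: (opp i l); congruence.
    by rewrite qC; intuition congruence.
  have t1 : q r k = i \/ q r k = l by apply: (opp i l); congruence.
  have t2 : q k r = i \/ q k r = j by apply: (opp i j); congruence.
  rewrite qC in t1; have qkr : q k r = i by intuition congruence.
  have : q i m = k \/ q i m = r by apply: (opp k r); congruence.
  by intuition congruence.
move=> i j l; rewrite /= !inE !negb_or andbT => /andP[/and3P[ij ik il]].
move=> /andP[/andP[jk jl] kl].
move: ij ik il jk jl kl => /eqP ij /eqP ik /eqP il /eqP jk /eqP jl /eqP kl.
have [ki|kj] : q (q i j) l = i \/ q (q i j) l = j by apply: (opp i j).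
  exact: (key i j (q i j) l).
by apply: (key j i (q i j) l) => //; congruence.
Qed.

(** * Tuples with prescribed letters *)

Lemma perm_cat_enum (T : finType) (s : seq T) :
  uniq s -> perm_eq (s ++ [seq i <- enum T | i \notin s]) (enum T).
Proof.
move=> s_uniq; apply: uniq_perm => [||i]; last 1 first.
- by rewrite mem_cat mem_filter mem_enum /= inE andbT orbN.
- rewrite cat_uniq s_uniq filter_uniq ?enum_uniq // andbT /=.
  by apply/hasPn => i; rewrite mem_filter => /andP[].
- exact: enum_uniq.
Qed.

Lemma perm_tnth_cat (A : eqType) (n : nat) (a : n.-tuple A) (ps : seq 'I_n) :
  uniq ps -> exists R, perm_eq a (map (tnth a) ps ++ R).
Proof.
move=> /perm_cat_enum/(perm_map (tnth a)).
rewrite map_cat map_tnth_enum perm_sym.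
by eexists; eassumption.
Qed.

(** Supplies the test tuples on which [g] is evaluated in two ways. *)
Lemma tuple_extension (A : eqType) (x0 : A) (n : nat) (ps : seq 'I_n)
    (vs R : seq A) :
  uniq ps -> size vs = size ps -> size (vs ++ R) = n ->
  exists a : n.-tuple A, map (tnth a) ps = vs /\ perm_eq a (vs ++ R).
Proof.
move=> ps_uniq size_vs size_n.
pose e := ps ++ [seq i <- enum 'I_n | i \notin ps].
have eE : perm_eq e (enum 'I_n) by exact: perm_cat_enum.
have e_uniq : uniq e by rewrite (perm_uniq eE) enum_uniq.
have size_e : size e = n by rewrite (perm_size eE) size_enum_ord.
pose a : n.-tuple A := [tuple nth x0 (vs ++ R) (index i e) | i < n].
have map_e : map (tnth a) e = vs ++ R.
  apply: (@eq_from_nth _ x0); rewrite size_map size_e // => i lt_i.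
  have i0 : 'I_n := Ordinal lt_i.
  by rewrite (nth_map i0) ?size_e // tnth_mktuple index_uniq ?size_e.
exists a; split.
  have := congr1 (take (size vs)) map_e.
  by rewrite take_size_cat // map_cat take_size_cat // size_map.
by rewrite -map_e -[X in perm_eq X _]map_tnth_enum perm_sym perm_map.
Qed.

(** * Exchange properties of functions of multisets *)

Definition weakly_exchangeable (A : eqType) (B : Type) (n : nat)
    (F : seq A -> B) : Prop :=
  forall u y R, size R + 4 = n ->
    F (u :: u :: u :: y :: R) = F (u :: u :: y :: y :: R).

(** A consequence of P, with the doubled [w] as catalyst; it serves as a halfway stage in refuting
    the failure of P. *)
Definition doubles_exchangeable (A : eqType) (B : Type) (n : nat)
    (F : seq A -> B) : Prop :=
  forall u y w R, size R + 5 = n ->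
    F (u :: u :: y :: w :: w :: R) = F (u :: y :: y :: w :: w :: R).

Definition perm_invariant (A : eqType) (B : Type) (F : seq A -> B) : Prop :=
  forall s t, perm_eq s t -> F s = F t.

(* Identifying the arguments i and j of g moves one copy of the repeated letter
   onto the letter at position q; q = i and q = j amount to no move. *)
Definition collapses_onto (A : eqType) (B : Type) (n : nat) (F : seq A -> B)
    (g : n.-tuple A -> B) (i j q : 'I_n) : Prop :=
  forall (a : n.-tuple A) s, tnth a i = tnth a j ->
    perm_eq a (tnth a i :: s) -> g a = F (tnth a q :: s).

(* Generalizing the booleans spares lia a case split on each of them. *)
Ltac perm_count :=
  apply/seq.permP => ? /=;
  repeat match goal with |- context [nat_of_bool ?b] =>
    move: (nat_of_bool b) => ? end;
  clear; lia.

Lemma collapses_onto_sym (A : eqType) (B : Type) (n : nat) (F : seq A -> B)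
    (g : n.-tuple A -> B) (i j q : 'I_n) :
  collapses_onto F g i j q -> collapses_onto F g j i q.
Proof. by move=> H a s ji; rewrite ji; apply: H. Qed.

(** Both sides have the form z + x + y + R, with z = x or z = y. If [x] or [y] recurs in [R], this
    is an instance of P; otherwise [R] has a doubled letter. *)
Lemma exchange_of_weak (A : eqType) (B : Type) (n : nat) (F : seq A -> B)
    (x y : A) (R : seq A) :
  perm_invariant F -> weakly_exchangeable n F ->
  size R + 3 = n -> ~~ uniq [:: x, y & R] ->
  F [:: x, x, y & R] = F [:: x, y, y & R].
Proof.
move=> Fp P sz; have [-> //|xy] := eqVneq x y.
have sub z s : z \in s -> exists s', perm_eq s (z :: s').
  by move=> zs; exists (rem z s); apply: perm_to_rem.
rewrite [F [:: x, y, y & R]](Fp _ [:: y, x, y & R]); last by perm_count.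
rewrite /= inE (negPf xy) /=; case: (boolP (x \in R)) => [/sub[R' eR] _|_ /=].
  have := perm_size eR; rewrite /= => szR.
  have e z : F [:: z, x, y & R] = F [:: x, x, z, y & R'].
    apply: Fp; move/seq.permP: eR => eR; apply/seq.permP => p.
    by move: (eR p) => /=; lia.
  by rewrite !e P //; lia.
case: (boolP (y \in R)) => [/sub[R' eR] _|_ /=].
  have := perm_size eR; rewrite /= => szR.
  have e z : F [:: z, x, y & R] = F [:: y, y, z, x & R'].
    apply: Fp; move/seq.permP: eR => eR; apply/seq.permP => p.
    by move: (eR p) => /=; lia.
  by rewrite !e P //; lia.
move=> Ru; have [w [R' eR]] : exists w R', perm_eq R [:: w, w & R'].
  elim: R Ru {sz} => [//|w R IH] /=; rewrite negb_and negbK.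
  case/orP=> [/sub[R' eR]|/IH[v [R' eR]]].
    by exists w, R'; rewrite perm_cons.
  exists v, (w :: R'); move/seq.permP: eR => eR; apply/seq.permP => p.
  by move: (eR p) => /=; lia.
have := perm_size eR; rewrite /= => szR.
have e z : F [:: z, x, y & R] = F [:: w, w, z, x & y :: R'].
  apply: Fp; move/seq.permP: eR => eR; apply/seq.permP => p.
  by move: (eR p) => /=; lia.
(* the doubled letter w serves as a catalyst: xxww -> xwww, wwwy -> wwyy *)
rewrite !e -P /=; last by lia.
rewrite (Fp _ [:: w, w, w, y & x :: R']); last by perm_count.
by rewrite P /=; [apply: Fp; perm_count | lia].
Qed.

(** If P fails, [tri] and [opp] hold and [opposite_map_inside] applies. For [opp], the value is
    first kept out of the second pair, then, by means of [Q], kept from being a fifth position. *)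
Lemma weakly_exchangeable_of_collapse (A : eqType) (B : Type) (n : nat)
    (F : seq A -> B) (g : n.-tuple A -> B) (q : 'I_n -> 'I_n -> 'I_n)
    (i j : 'I_n) :
  perm_invariant F -> (forall i j, q i j = q j i) ->
  (forall i j, i != j -> collapses_onto F g i j (q i j)) ->
  3 < n -> i != j -> q i j \notin [:: i; j] -> weakly_exchangeable n F.
Proof.
move=> Fp qC qg n_gt3 ij qij; apply: contrapT => nP.
have pick (s : seq 'I_n) : size s < n -> exists l, l \notin s.
  move=> lt_s; case: (pickP (fun l => l \notin s)) => [l|all_s].
    by exists l.
  have /(uniq_leq_size (enum_uniq 'I_n)) : {subset enum 'I_n <= s}.
    by move=> l _; have /negbFE := all_s l.
  by rewrite size_enum_ord leqNgt lt_s.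
(* Put [u] at the three positions and [y] at [q i1 i2]: the pair [i1], [i2] gives 2u + 2y, while a
   value of [q i1 i3] inside the triple gives 3u + y. *)
have tri i1 i2 i3 : i1 <> i2 -> i1 <> i3 -> i2 <> i3 ->
    q i1 i2 \notin [:: i1; i2; i3] -> q i1 i3 \notin [:: i1; i2; i3].
  move=> /eqP n12 /eqP n13 /eqP n23 out; apply/negP => ins; apply: nP.
  move=> u y R szR.
  have [] := @tuple_extension _ u n [:: i1; i2; i3; q i1 i2] [:: u; u; u; y] R.
  - by move: out; rewrite /= !inE !negb_or n12 n13 n23 !(eq_sym (q _ _)) !andbT
      => /and3P[-> -> ->].
  - by [].
  - by rewrite /= -szR; clear; lia.
  move=> a [[a1 a2 a3 aq] /= ea].
  have ga : g a = F [:: y, u, u, y & R].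
    by rewrite (qg _ _ n12 a [:: u, u, y & R]) ?aq ?a1 ?a2.
  have gb : g a = F [:: u, u, u, y & R].
    rewrite (qg _ _ n13 a [:: u, u, y & R]) ?a1 ?a3 //.
    by move: ins; rewrite !inE => /or3P[] /eqP ->; rewrite ?a1 ?a2 ?a3.
  by rewrite -gb ga; apply: Fp; perm_count.
(* With [y] at [i1], [i2] and [u] at the other two, the first pair gives 3u + y; the second would
   leave 2u + 2y unchanged. *)
have opp_outside i1 i2 i4 : uniq [:: i1; i2; q i1 i2; i4] ->
    q (q i1 i2) i4 \notin [:: q i1 i2; i4].
  move=> i_uniq; apply/negP => ins; apply: nP => u y R szR.
  have [//||a [[a1 a2 a3 a4] /= ea]] :=
    @tuple_extension _ u n _ [:: y; y; u; u] R i_uniq.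
    by rewrite /= -szR; clear; lia.
  have ga : g a = F [:: u, y, u, u & R].
    rewrite (qg i1 i2 _ a [:: y, u, u & R]) ?a1 ?a2 ?a3 //.
    by move: i_uniq; rewrite /= !inE !negb_or => /andP[/and3P[]].
  have gb : g a = F [:: u, u, y, y & R].
    rewrite (qg (q i1 i2) i4 _ a [:: u, y, y & R]) ?a3 ?a4 //.
    - by move: ins; rewrite !inE => /orP[] /eqP ->; rewrite ?a3 ?a4.
    - by move: i_uniq; rewrite /= !inE !negb_or => /and4P[_ _].
    - by rewrite (permPl ea); perm_count.
  by rewrite -gb ga; apply: Fp; perm_count.
have [l lP] : exists l, l \notin [:: i; j; q i j] by apply: pick.
have ijl_uniq : uniq [:: i; j; q i j; l].
  move: qij lP; rewrite /= !inE !negb_or ij !(eq_sym (q _ _)) !(eq_sym l) /=.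
  by rewrite !andbT => /andP[-> ->] /and3P[-> -> ->].
have Q : doubles_exchangeable n F.
  apply: contrapT => nQ.
  (* With [w] at the triple and [u], [y] at two distinct values of [q], the two evaluations are the
     two sides of [Q]. *)
  have spread i1 i2 i3 : i1 != i2 -> i1 != i3 -> i2 != i3 ->
      q i1 i2 \notin [:: i1; i2; i3] -> q i1 i3 = q i1 i2.
    move=> n12 n13 n23 out; apply/eqP/negP => /negP neq; apply: nQ.
    have out' : q i1 i3 \notin [:: i1; i2; i3] by apply: tri => //; apply/eqP.
    move=> u y w R szR.
    have [] := @tuple_extension _ u n [:: i1; i2; i3; q i1 i2; q i1 i3]
      [:: w; w; w; u; y] R.
    - move: out out'; rewrite /= !inE !negb_or n12 n13 n23 !andbT.
      rewrite ![_ == q i1 i2]eq_sym ![_ == q i1 i3]eq_sym neq.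
      by move=> /and3P[-> -> ->] /and3P[-> -> ->].
    - by [].
    - by rewrite /= -szR; clear; lia.
    move=> a [[a1 a2 a3 au ay] /= ea].
    have ga : g a = F [:: u, w, w, u, y & R].
      by rewrite (qg _ _ n12 a [:: w, w, u, y & R]) ?au ?a1 ?a2.
    have gb : g a = F [:: y, w, w, u, y & R].
      by rewrite (qg _ _ n13 a [:: w, w, u, y & R]) ?ay ?a1 ?a3.
    rewrite (Fp _ [:: u, w, w, u, y & R]); last by perm_count.
    by rewrite -ga gb; apply: Fp; perm_count.
  (* By [spread], the pairs from [i], [j], [l] share the value [q i j]; then [tri] forces
     [q (q i j) l] to be both [i] and [j]. *)
  move: (opp_outside _ _ _ ijl_uniq) (ijl_uniq).
  rewrite /= !inE !negb_or !andbT => out.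
  move=> /and3P[/and3P[_ ik il] /andP[jk jl] kl].
  have qil : q i l = q i j.
    by apply: spread; rewrite // !inE !negb_or !(eq_sym (q i j)) ik jk
      (eq_sym l) kl.
  have qjl : q j l = q i j.
    rewrite (qC i j); apply: spread; rewrite // 1?eq_sym //.
    by rewrite (qC j i) !inE !negb_or !(eq_sym (q i j)) ik jk (eq_sym l) kl.
  have inside i1 : i1 != q i j -> i1 != l -> q i1 l = q i j ->
      q (q i j) l = i1.
    move=> i1k i1l q1l; apply/eqP; move: out; apply: contraLR => neq.
    apply/negP => out.
    have : q l i1 \notin [:: l; q i j; i1].
      apply: tri; rewrite 1?(qC l) ?inE ?negb_or.
      - by move/eqP: kl; congruence.
      - by move/eqP: i1l; congruence.
      - by move/eqP: i1k; congruence.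
      - by rewrite neq andbT andbC.
    by rewrite qC q1l !inE eqxx orbT.
  by have := ij; rewrite -(inside _ ik il qil) (inside _ jk jl qjl) eqxx.
have opp i1 i2 i4 : uniq [:: i1; i2; q i1 i2; i4] ->
    q (q i1 i2) i4 \in [:: i1; i2].
  move=> i_uniq; apply/negPn/negP => out.
  have out' := opp_outside _ _ _ i_uniq.
  have m_uniq : uniq [:: q (q i1 i2) i4; i1; i2; q i1 i2; i4].
    by rewrite cons_uniq i_uniq andbT !inE; move: out out'; rewrite !inE;
      do !case: eqP.
  (* Five distinct positions give n >= 5, hence a further letter [z], put at the fifth. The
     evaluations are 3u + y + z and u + 2y + 2z; [Q] with catalyst [y] turns the latter into 2u + 2y
     + z. *)
  apply: nP => u y [|z R] szR.
    have /(uniq_leq_size m_uniq) :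
        {subset [:: q (q i1 i2) i4; i1; i2; q i1 i2; i4] <= enum 'I_n}.
      by move=> ? _; rewrite mem_enum.
    by rewrite size_enum_ord => /leq_trans/(_ (eq_leq (esym szR))).
  have [//||a [[am a1 a2 a3 a4] /= ea]] :=
    @tuple_extension _ u n _ [:: z; y; y; u; u] R m_uniq.
    by rewrite /= -szR /=; clear; lia.
  have ga : g a = F [:: u, y, u, u, z & R].
    rewrite (qg i1 i2 _ a [:: y, u, u, z & R]) ?a1 ?a2 ?a3 //.
      by move: i_uniq; rewrite /= !inE !negb_or => /andP[/and3P[]].
    by rewrite (permPl ea); perm_count.
  have gb : g a = F [:: z, u, y, y, z & R].
    rewrite (qg (q i1 i2) i4 _ a [:: u, y, y, z & R]) ?a3 ?a4 ?am //.
      by move: i_uniq; rewrite /= !inE !negb_or => /and4P[_ _].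
    by rewrite (permPl ea); perm_count.
  rewrite (Fp _ [:: u, y, u, u, z & R]); last by perm_count.
  rewrite -ga gb (Fp _ [:: u, z, z, y, y & R]); last by perm_count.
  rewrite -Q; last by rewrite -szR /=; clear; lia.
  by apply: Fp; perm_count.
exact: (opposite_map_inside qC tri opp ijl_uniq).
Qed.

(** * Identification minors and the cards of a reconstruction *)

Lemma tnth_tuple_comp (A : Type) (m n : nat) (a : n.-tuple A)
    (s : 'I_m -> 'I_n) (i : 'I_m) : tnth (tuple_comp a s) i = tnth a (s i).
Proof. exact: tnth_mktuple. Qed.

(** Positions other than [i] contribute each letter of [b] once, and [i] repeats one. Applied with
    [d] a [delta I] and [i] the maximum of [I]. *)
Lemma perm_tuple_comp_cons (A : eqType) (n : nat) (i : 'I_n)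
    (b : n.-1.-tuple A) (d : 'I_n -> 'I_n.-1) :
  cancel (lift i) d -> perm_eq (tuple_comp b d) (tnth b (d i) :: b).
Proof.
move=> liftK; rewrite -[X in perm_eq X]map_tnth_enum.
have /(perm_map (tnth (tuple_comp b d)))/permPl-> :
    perm_eq (enum 'I_n) (i :: map (lift i) (enum 'I_n.-1)).
  apply: uniq_perm => [||k]; first exact: enum_uniq.
    rewrite /= map_inj_uniq ?enum_uniq ?andbT; last exact: lift_inj.
    by apply/mapP => -[k _ /eqP]; rewrite (negPf (neq_lift _ _)).
  rewrite mem_enum !inE; case: (unliftP i k) => [k' ->|->]; last first.
    by rewrite eqxx.
  by rewrite map_f ?orbT ?mem_enum.
rewrite /= tnth_tuple_comp perm_cons -map_comp -[X in perm_eq _ X]map_tnth_enum.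
rewrite (eq_map (g := tnth b)) // => k /=.
by rewrite tnth_tuple_comp liftK.
Qed.

Lemma pairs_ltn (n : nat) (I : pairs n) :
  exists i j : 'I_n, i < j /\ val I = [set i; j].
Proof.
have /cards2P[i [j [neq_ij Iij]]] := valP I.
move: neq_ij; rewrite -val_eqE neq_ltn /= => /orP[lt_ij|lt_ji].
  by exists i, j.
by exists j, i; rewrite finset.setUC.
Qed.

Lemma maxI_set2 (n : nat) (I : pairs n) (i j : 'I_n) :
  i < j -> val I = [set i; j] -> maxI I = j.
Proof.
move=> lt_ij; rewrite /maxI => ->; rewrite big_setU1 ?big_set1 /=.
  exact/maxn_idPr/ltnW.
by rewrite inE -val_eqE neq_ltn lt_ij.
Qed.

Lemma minI_set2 (n : nat) (I : pairs n) (i j : 'I_n) :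
  i < j -> val I = [set i; j] -> minI I = i.
Proof.
move=> lt_ij Iij; apply/eqP; rewrite eqn_leq minI_le; last by rewrite Iij set21.
rewrite /= /minI; elim/big_ind: _ => [|x y|k]; first exact: ltnW.
  by rewrite leq_min => -> ->.
by rewrite Iij => /set2P[] -> //; apply: ltnW.
Qed.

Lemma liftK_delta (n : nat) (I : pairs n) (i j : 'I_n) :
  i < j -> val I = [set i; j] -> cancel (lift j) (delta I).
Proof.
move=> lt_ij Iij l; apply: val_inj; rewrite /= /delta_nat (maxI_set2 lt_ij Iij).
rewrite /bump; have [le_jl|lt_lj] := leqP j l; last by rewrite add0n lt_lj.
by rewrite add1n ltnNge ltnW //= gtn_eqF.
Qed.

Lemma minor_lift (A B : Type) (n : nat) (g : n.-tuple A -> B) (I : pairs n)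
    (i j : 'I_n) (a : n.-tuple A) :
  i < j -> val I = [set i; j] -> tnth a i = tnth a j ->
  minor g I (tuple_comp a (lift j)) = g a.
Proof.
move=> lt_ij Iij aij; congr g; apply: eq_from_tnth => k.
rewrite !tnth_tuple_comp; case: (unliftP j k) => [k' ->|->].
  by rewrite (liftK_delta lt_ij Iij).
rewrite -aij; congr tnth; apply: val_inj; rewrite /= /delta_nat.
rewrite (maxI_set2 lt_ij Iij) ltnn eqxx (minI_set2 lt_ij Iij) /bump.
by rewrite leqNgt lt_ij.
Qed.

Lemma fequiv_minors_of_reconstruction (A B : Type) (n : nat)
    (f g : n.-tuple A -> B) (I : pairs n) :
  reconstruction f g -> exists J, fequiv (minor f J) (minor g I).
Proof.
move=> /eq_seq_msetP/perm_mem/(_ (fclass (minor g I))).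
rewrite [RHS]map_f ?mem_enum // => /mapP[J _ eIJ]; exists J.
suff : fclass (minor g I) (minor g I) by rewrite eIJ.
exists 1%g => b; congr (minor g I); apply: eq_from_tnth => i.
by rewrite tnth_tuple_comp perm1.
Qed.

Lemma reconstruction_collapses (A : eqType) (B : Type) (n : nat)
    (F : seq A -> B) (f g : n.-tuple A -> B) (i j : 'I_n) :
  perm_invariant F -> (forall a : n.-tuple A, f a = F a) ->
  reconstruction f g -> i != j -> exists q, collapses_onto F g i j q.
Proof.
move=> Fp fF fg; wlog lt_ij : i j / i < j => [hw neq_ij|_].
  have [lt_ij|lt_ji|/val_inj eq_ij] := ltngtP i j; first exact: hw.
    have [|q Hq] := hw j i lt_ji; first by rewrite eq_sym.
    by exists q; apply: collapses_onto_sym.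
  by rewrite eq_ij eqxx in neq_ij.
have card_ij : #|[set i; j]| == 2.
  by rewrite cards2 -val_eqE neq_ltn lt_ij.
pose I : pairs n := exist _ [set i; j] card_ij.
have [J [s fgs]] := fequiv_minors_of_reconstruction I fg.
have [i' [j' [lt_ij' Jij]]] := pairs_ltn J.
(* The argument [delta J j'] of the card of [f] is the one counted twice; [s^-1] carries it to the
   card of [g], and [lift j] to a position of [g]. *)
exists (lift j ((s^-1)%g (delta J j'))) => a t aij eat.
set b := tuple_comp a (lift j).
have eab : perm_eq a (tnth a j :: b).
  have ea : tuple_comp b (delta I) = a.
    exact: (minor_lift id (I := I) lt_ij (erefl _) aij).
  have := perm_tuple_comp_cons b (liftK_delta (I := I) lt_ij (erefl _)).
  by rewrite -tnth_tuple_comp ea.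
have ebt : perm_eq b t.
  by rewrite -(perm_cons (tnth a i)) -(permPr eat) aij perm_sym.
rewrite -(minor_lift g (I := I) lt_ij) // -/b.
have -> : b = tuple_comp (tuple_comp b (s^-1)%g) s.
  by apply: eq_from_tnth => k; rewrite !tnth_tuple_comp permK.
rewrite -fgs /minor fF; apply: Fp.
apply: (perm_trans (perm_tuple_comp_cons _ (liftK_delta lt_ij' Jij))).
rewrite !tnth_tuple_comp perm_cons; apply: perm_trans ebt.
by apply/tuple_permP; exists (s^-1)%g.
Qed.

Theorem theorem5p1 (A : finType) (B : Type) (k n : nat)
    (A_ge2 : 2 <= #|A|) (B_ge2 : exists b1 b2 : B, b1 <> b2)
    (cardA : #|A| = k) (n_ge : k + 2 <= n)
    (f : n.-tuple A -> B) (f_sym : totally_symmetric f) :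
  reconstructible f.
Proof.
move=> g fg.
have [x0 _] : exists x : A, x \in A by apply/card_gt0P/ltnW.
(* On lists of length other than n, [F] is constant, so invariance holds there too. *)
pose F s := f (insubd (nseq_tuple n x0) s).
have fF (a : n.-tuple A) : f a = F a by rewrite /F valKd.
have Fp : perm_invariant F.
  move=> s t st; rewrite /F /insubd; case: insubP => [a _ ea|nsz].
    rewrite insubT => [|szt]; first by rewrite -(perm_size st) -ea size_tuple.
    move=> /=; rewrite -ea in st.
    have /tuple_permP[p] : perm_eq a (Sub t szt : n.-tuple A) by [].
    move=> eap; rewrite [RHS](f_sym _ p); congr f; exact: val_inj.
  by rewrite insubN // -(perm_size st).
have [q qg] : exists q : 'I_n -> 'I_n -> 'I_n, (forall i j, q i j = q j i) /\
    forall i j, i != j -> collapses_onto F g i j (q i j).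
  have /choice[q0 q0g] : forall p : 'I_n * 'I_n, exists q : 'I_n,
      p.1 != p.2 -> collapses_onto F g p.1 p.2 q.
    move=> [i j]; case: (eqVneq i j) => [_|ij]; first by exists i.
    by have [q qij] := reconstruction_collapses Fp fF fg ij; exists q.
  (* Reading [q0] at the increasing pair makes [q] symmetric. *)
  exists (fun i j : 'I_n => if i < j then q0 (i, j) else q0 (j, i)).
  split=> i j.
    by case: ltngtP => // /val_inj->.
  move=> ij; case: ifP => _; first exact: (q0g (i, j)).
  by apply/collapses_onto_sym/(q0g (j, i)); rewrite eq_sym.
case: qg => qC qg.
suff gF a : g a = F a.
  exists 1%g => a; rewrite fF gF; congr F; congr val.
  by apply: eq_from_tnth => i; rewrite tnth_tuple_comp perm1.
have /injectivePn[i [j ij aij]] : ~~ injectiveb (tnth a).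
  apply/injectiveP => /leq_card; rewrite card_ord cardA => ?.
  by move: n_ge; lia.
have [q_in|q_out] := boolP (q i j \in [:: i; j]).
  have [t /= eat] := perm_tnth_cat a (isT : uniq [:: i]).
  rewrite (qg _ _ ij _ t) // (Fp _ _ eat).
  by move: q_in; rewrite !inE => /orP[] /eqP->; rewrite ?aij.
have ijq_uniq : uniq [:: i; j; q i j].
  by move: q_out; rewrite /= !inE !negb_or ij !(eq_sym (q i j)) andbT.
have [R /= eR] := perm_tnth_cat a ijq_uniq.
have szR := perm_size eR; rewrite size_tuple /= in szR.
rewrite (Fp _ _ eR) (qg _ _ ij _ [:: tnth a j, tnth a (q i j) & R]) // -aij.
rewrite (Fp _ [:: tnth a i, tnth a (q i j), tnth a (q i j) & R]); last first.
  by perm_count.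
apply/esym; apply: (exchange_of_weak (n := n)) => //.
- by apply: (weakly_exchangeable_of_collapse Fp qC qg _ ij q_out); lia.
- by rewrite addn3 szR.
(* With one copy of the letter shared by [i] and [j] dropped, n - 1 > k letters remain, so they
   cannot be distinct. *)
apply/negP => /card_uniqP /= sz.
have := max_card (mem [:: tnth a i, tnth a (q i j) & R]).
by rewrite sz cardA; lia.
Qed.
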